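(* One has $$ \int_{0}^{\infty}\frac{(\mathrm{Si}\, t)^3}{t^3}\,\mathrm{d}t=\frac{33}{32}\pi-\frac{1}{32}\pi^3 . $$
   Context: $\mathrm{Si}$ denotes the integral sine, $\mathrm{Si}\,t=\int_0^t\frac{\sin\alpha}{\alpha}\,\mathrm{d}\alpha$. *)

(* Defs.v *)
From Stdlib Require Import Reals.
From Coquelicot Require Import Coquelicot.

Open Scope R_scope.

(* At a = 0 the integrand evaluates to 0 rather than to its limit 1; a single
   point changes neither the integrability nor the integral. *)
Definition Si (t : R) : R := RInt (fun a : R => sin a / a) 0 t.

(* Main.v *)
Require Import Defs.
From Stdlib Require Import Reals Lra.
From Coquelicot Require Import Coquelicot.

Open Scope R_scope.

(** Since Si' (t) = sin t / t, repeated integration by parts lowers the power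
    of t in the denominator of Si(t)^3 / t^3. It stops at an antiderivative on
    (0, +oo) that is a combination of
    - boundary terms such as Si(t)^3 / t^2 or Si(t)^2 cos t / t, which vanish
      at 0 and at infinity;
    - Si(t)^3, Si(t) and Si(3 t), the last two coming from the linearized
      powers of sin and cos divided by t;
    - K(t), the integral of Si(s) cos(2 s) / s over [0, t]
    ([Si3_primitive], [is_derive_Si3_primitive]). All these functions
    extend continuously by 0 to t = 0, so the integral over [0, T] is the value
    at T, and two limits at infinity remain.

    - Si(T) tends to PI / 2. For every A, the sum
        Si(T) - int_0^T sin(t)/t e^(-A t) dt
              + int_0^A e^(-T x) (cos T + x sin T) / (1 + x^2) dx
      does not depend on T, hence equals its value atan A at T = 0
      ([Dirichlet_regularized]). The first integral is O(1/A) and the second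
      O(1/T), so A -> +oo gives |Si(T) - PI/2| <= 2/T ([Si_asymptotic]).

    - K(T) tends to 0. Replace Si(s) by Si(a s), 0 <= a <= 1. The a-derivative
      of the resulting integral is int_0^T sin(a t)/(a t) cos(2 t) dt, which is
        (Si((2 + a) T) - Si((2 - a) T)) / (2 a).
      As 2 - a is at least 1, both arguments of Si are at least T: this is at
      most 1 because |Si'(t)| <= 1/t, and at most 2/(a T) by the previous rate
      of convergence. Integrating the first bound over a in [0, d] and the
      second over [d, 1] gives |K(T)| <= d + 2/(d T)
      ([RInt_cos2_Si_bound]).

    With L the limit PI/2 of the integral of sin t sin(2 t) / t^2, the
    antiderivative tends to
      3/2 * 1/2 * (- (PI/2)^3 / 3 + 3/4 L + 2 L) = 33/32 PI - PI^3/32. *)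

(** * Integrals of continuous functions and the function sin(t)/t *)

(** With h(0) = 0 and h'(0) = l this is the difference quotient of h at 0, completed
    so as to be continuous. The bare quotients sin t / t and Si(a t) / t evaluate to 0
    at t = 0, where the theorems on integrals of continuous functions would not apply. *)
Definition dslope (h : R -> R) (l x : R) : R :=
  if Req_dec_T x 0 then l else h x / x.

Lemma dslope_neq0 h l x : x <> 0 -> dslope h l x = h x / x.
Proof. unfold dslope; destruct (Req_dec_T x 0); tauto. Qed.

Lemma dslope_0 h l : dslope h l 0 = l.
Proof. unfold dslope; destruct (Req_dec_T 0 0); tauto. Qed.

Lemma locally_neq0 (x : R) : x <> 0 -> locally x (fun y => y <> 0).
Proof.
intros Hx; exists (mkposreal _ (Rabs_pos_lt _ Hx)); intros y Hy ->.
change (Rabs (0 - x) < Rabs x) in Hy.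
rewrite Rminus_0_l, Rabs_Ropp in Hy; lra.
Qed.

Lemma continuous_dslope h l x :
  h 0 = 0 -> is_derive h 0 l -> (forall y, continuous h y) ->
  continuous (dslope h l) x.
Proof.
intros H0 Hl Hc; destruct (Req_dec_T x 0) as [->|Hx].
- apply continuity_pt_filterlim, continuity_pt_filterlim'; rewrite dslope_0.
  apply is_derive_Reals in Hl.
  intros P [eps HP]; destruct (Hl eps (cond_pos eps)) as [d Hd].
  exists d; intros y Hy Hy0; apply HP.
  assert (Hy' : Rabs y < d) by (now rewrite <- (Rminus_0_r y)).
  specialize (Hd y Hy0 Hy').
  rewrite dslope_neq0 by assumption.
  rewrite Rplus_0_l, H0, Rminus_0_r in Hd; exact Hd.
- apply continuous_ext_loc with (fun y => h y * / y).
  + apply filter_imp with (2 := locally_neq0 x Hx).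
    intros y Hy; symmetry; now apply dslope_neq0.
  + apply (continuous_mult h (fun y => / y)); [apply Hc|].
    now apply continuous_Rinv.
Qed.

Definition sinc : R -> R := dslope sin 1.

(** Multiplied by x, the case distinction at 0 disappears: this is how trigonometric
    identities and bounds on sin transfer to [sinc]. *)
Lemma sinc_mult x : x * sinc x = sin x.
Proof.
unfold sinc; destruct (Req_dec_T x 0) as [->|Hx].
- rewrite sin_0; ring.
- rewrite dslope_neq0 by easy; now field.
Qed.

Lemma continuous_sinc x : continuous sinc x.
Proof.
apply continuous_dslope.
- apply sin_0.
- rewrite <- cos_0; apply is_derive_sin.
- intros y; apply continuous_sin.
Qed.

Lemma sinc_bound x : Rabs (sinc x) <= 1.
Proof.
destruct (Req_dec_T x 0) as [->|Hx].
- unfold sinc; rewrite dslope_0, Rabs_R1; lra.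
- assert (Hs : Rabs (sin x) <= Rabs x).
  { destruct (Rle_lt_dec x 0) as [H|H].
    - rewrite (Rabs_left1 x H), <- (Rabs_Ropp (sin x)), <- sin_neg.
      pose proof (sin_lt_x (- x)); pose proof (SIN_bound (- x)).
      destruct (Rle_lt_dec 1 (- x)); [apply Rabs_le; lra|].
      rewrite Rabs_pos_eq; [lra|].
      apply sin_ge_0; pose proof PI2_1; lra.
    - rewrite (Rabs_pos_eq x) by lra.
      pose proof (sin_lt_x x); pose proof (SIN_bound x).
      destruct (Rle_lt_dec 1 x); [apply Rabs_le; lra|].
      rewrite Rabs_pos_eq; [lra|].
      apply sin_ge_0; pose proof PI2_1; lra. }
  rewrite <- (sinc_mult x), Rabs_mult in Hs.
  apply Rmult_le_reg_l with (Rabs x); [now apply Rabs_pos_lt|lra].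
Qed.

Lemma ex_RInt_cont (f : R -> R) a b : (forall x, continuous f x) -> ex_RInt f a b.
Proof. intros H; apply (ex_RInt_continuous (V := R_CompleteNormedModule)); auto. Qed.

Lemma is_derive_RInt_cont (f : R -> R) x :
  (forall y, continuous f y) -> is_derive (RInt f 0) x (f x).
Proof.
intros H; apply (is_derive_RInt (V := R_NormedModule) f _ 0); [|apply H].
apply filter_forall; intros y.
apply (RInt_correct (V := R_CompleteNormedModule)); now apply ex_RInt_cont.
Qed.

Lemma is_derive_Si x : is_derive Si x (sinc x).
Proof.
apply is_derive_ext with (RInt sinc 0).
- intros t; unfold Si; apply RInt_ext; intros y Hy.
  apply dslope_neq0; unfold Rmin, Rmax in Hy.
  destruct (Rle_dec 0 t); lra.
- apply is_derive_RInt_cont, continuous_sinc.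
Qed.

Lemma Si_0 : Si 0 = 0.
Proof. apply (RInt_point (V := R_CompleteNormedModule)). Qed.

Lemma continuous_Si x : continuous Si x.
Proof. apply (ex_derive_continuous Si); eexists; apply is_derive_Si. Qed.

(** Differentiation under the integral sign, for data regular on the whole plane. *)
Lemma is_derive_RInt_param_cont (f df : R -> R -> R) a b x :
  (forall u t, is_derive (fun v => f v t) u (df u t)) ->
  (forall u t, continuity_2d_pt df u t) ->
  (forall u t, continuous (f u) t) ->
  is_derive (fun u => RInt (f u) a b) x (RInt (df x) a b).
Proof.
intros Hd Hc Hf.
rewrite <- (RInt_ext (fun t => Derive (fun u => f u t) x)).
- apply (is_derive_RInt_param f).
  + apply filter_forall; intros u t _; eexists; apply Hd.
  + intros t _; apply continuity_2d_pt_ext with df; [|apply Hc].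
    intros u v; symmetry; apply is_derive_unique, Hd.
  + apply filter_forall; intros u; apply ex_RInt_cont, Hf.
- intros t _; apply is_derive_unique, Hd.
Qed.

Lemma constant_of_derive_0 (f : R -> R) x y :
  (forall t, is_derive f t 0) -> f x = f y.
Proof.
intros H; destruct (MVT_gen f x y (fun _ => 0)) as (c & _ & Hc).
- intros t _; apply H.
- intros t _; apply continuity_pt_filterlim, (ex_derive_continuous f).
  now exists 0.
- lra.
Qed.

(** * The Dirichlet integral *)

Lemma is_RInt_exp_decay c M b : c <> 0 ->
  is_RInt (fun t => M * exp (- (c * t))) 0 b (M / c * (1 - exp (- (c * b)))).
Proof.
intros Hc.
replace (M / c * (1 - exp (- (c * b)))) with
  (minus (- (M / c * exp (- (c * b)))) (- (M / c * exp (- (c * 0))))).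
2:{ unfold minus, plus, opp; simpl; rewrite Rmult_0_r, Ropp_0, exp_0; ring. }
apply (is_RInt_derive (V := R_CompleteNormedModule)
         (fun t => - (M / c * exp (- (c * t))))).
- intros t _; auto_derive; [easy|]; field; easy.
- intros t _; apply (ex_derive_continuous (fun t => M * exp (- (c * t)))).
  auto_derive; easy.
Qed.

(** Uniform in b: this yields the O(1/A) and O(1/T) bounds on the two integrals of
    [Dirichlet_regularized]. *)
Lemma abs_RInt_exp_decay (g : R -> R) c M b : 0 < c -> 0 <= M -> 0 <= b ->
  (forall t, continuous g t) ->
  (forall t, 0 <= t -> Rabs (g t) <= M * exp (- (c * t))) ->
  Rabs (RInt g 0 b) <= M / c.
Proof.
intros Hc HM Hb Hg Hle.
pose proof (is_RInt_exp_decay c M b ltac:(lra)) as HI.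
apply Rle_trans with (M / c * (1 - exp (- (c * b)))).
- apply (norm_RInt_le (V := R_NormedModule) g
           (fun t => M * exp (- (c * t))) 0 b); try assumption.
  + intros t Ht; apply Hle; lra.
  + apply (RInt_correct (V := R_CompleteNormedModule)).
    now apply ex_RInt_cont.
- assert (0 <= M / c) by (apply Rle_div_r; lra).
  pose proof (exp_pos (- (c * b))); nra.
Qed.

Lemma continuity_2d_exp_mult u t : continuity_2d_pt (fun u t : R => exp (- (u * t))) u t.
Proof.
apply (continuity_1d_2d_pt_comp exp (fun u t => - (u * t))).
- apply derivable_continuous_pt, derivable_pt_exp.
- apply continuity_2d_pt_opp, continuity_2d_pt_mult;
    [apply continuity_2d_pt_id1|apply continuity_2d_pt_id2].
Qed.

Lemma continuous_sinc_exp A t : continuous (fun t => sinc t * exp (- (A * t))) t.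
Proof.
apply (continuous_mult sinc (fun t => exp (- (A * t)))); [apply continuous_sinc|].
apply (ex_derive_continuous (fun t => exp (- (A * t)))); auto_derive; easy.
Qed.

(** Differentiating in T under the second integral cancels the denominator 1 + x^2 and
    leaves - sin T times the integral of e^(-T x) over [0, A], that is
    - sin(T)/T * (1 - e^(-A T)), the opposite of the derivative of the other two
    terms. *)
Lemma Dirichlet_regularized A T :
  Si T - RInt (fun t => sinc t * exp (- (A * t))) 0 T
    + RInt (fun x => exp (- (T * x)) * (cos T + x * sin T) / (1 + x ^ 2)) 0 A
  = atan A.
Proof.
set (P := fun T => RInt (fun t => sinc t * exp (- (A * t))) 0 T).
set (q := fun T x => exp (- (T * x)) * (cos T + x * sin T) / (1 + x ^ 2)).
set (Q := fun T => RInt (q T) 0 A).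
change (Si T - P T + Q T = atan A).
assert (HP : forall T, is_derive P T (sinc T * exp (- (A * T)))).
{ intros S; apply (is_derive_RInt_cont (fun t => sinc t * exp (- (A * t)))).
  intros y; apply continuous_sinc_exp. }
assert (Hpos : forall x, 1 + x ^ 2 <> 0) by (intros x; nra).
assert (HQ : forall T, is_derive Q T (RInt (fun x => - sin T * exp (- (T * x))) 0 A)).
{ intros S.
  apply (is_derive_RInt_param_cont q (fun T x => - sin T * exp (- (T * x)))).
  - intros u x; unfold q; auto_derive; [easy|]; field; pose proof (Hpos x); nra.
  - intros u x; apply continuity_2d_pt_mult; [|apply continuity_2d_exp_mult].
    apply (continuity_1d_2d_pt_comp (fun u => - sin u) (fun u t => u));
      [|apply continuity_2d_pt_id1].
    apply continuity_pt_filterlim, (ex_derive_continuous (fun u => - sin u)).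
    auto_derive; easy.
  - intros u x; apply (ex_derive_continuous (q u)); unfold q; auto_derive.
    apply Hpos. }
assert (HI : forall T, RInt (fun x => - sin T * exp (- (T * x))) 0 A
                       = - sinc T * (1 - exp (- (A * T)))).
{ intros S; destruct (Req_dec_T S 0) as [->|HS].
  - rewrite (Rmult_0_r A), Ropp_0, exp_0, (RInt_ext _ (fun _ => 0)).
    + rewrite RInt_const.
      unfold scal; simpl; unfold mult; simpl; ring.
    + intros x _; rewrite sin_0; simpl; ring.
  - unfold sinc; rewrite dslope_neq0 by easy.
    rewrite (is_RInt_unique _ _ _ _ (is_RInt_exp_decay S (- sin S) A HS)).
    rewrite (Rmult_comm S A).
    match goal with |- ?a = ?b => change (@eq R a b) end; field; easy. }
rewrite (constant_of_derive_0 (fun T => Si T - P T + Q T) T 0).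
- rewrite Si_0; unfold P, Q; rewrite RInt_point.
  rewrite (RInt_ext _ (fun x => / (1 + x ^ 2))).
  2:{ intros x _; unfold q; rewrite Rmult_0_l, Ropp_0, exp_0, cos_0, sin_0.
      pose proof (Hpos x).
      match goal with |- ?a = ?b => change (@eq R a b) end; field; nra. }
  rewrite (is_RInt_unique _ 0 A (minus (atan A) (atan 0))).
  + rewrite atan_0; unfold minus, plus, opp, zero; simpl; ring.
  + apply (is_RInt_derive (V := R_CompleteNormedModule) atan).
    * intros x _; apply is_derive_Reals, derivable_pt_lim_atan.
    * intros x _; apply (ex_derive_continuous (fun x => / (1 + x ^ 2))).
      auto_derive; apply Hpos.
- intros t.
  replace 0 with (sinc t - sinc t * exp (- (A * t))
    + RInt (fun x => - sin t * exp (- (t * x))) 0 A) by (rewrite HI; ring).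
  apply (is_derive_plus (V := R_NormedModule)); [|apply HQ].
  apply (is_derive_minus (V := R_NormedModule)); [apply is_derive_Si|apply HP].
Qed.

Lemma Si_asymptotic T : 0 < T -> Rabs (Si T - PI / 2) <= 2 / T.
Proof.
intros HT; apply le_epsilon; intros e He.
(* The two errors that depend on A, in atan A and in the damped integral, are at most
   1 / A each. *)
set (A := 2 / e).
assert (HA : 0 < A) by (apply Rdiv_lt_0_compat; lra).
assert (Ha : Rabs (atan A - PI / 2) <= / A).
{ rewrite Rabs_minus_sym, <- atan_inv by easy.
  pose proof (Rinv_0_lt_compat A HA) as HA'.
  destruct (MVT_gen atan 0 (/ A) (fun x => / (1 + x ^ 2))) as (c & _ & Hc).
  - intros x _; apply is_derive_Reals, derivable_pt_lim_atan.
  - intros x _; apply derivable_continuous_pt, derivable_pt_atan.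
  - rewrite atan_0, !Rminus_0_r in Hc; rewrite Hc.
    assert (H1 : 0 < / (1 + c ^ 2)) by (apply Rinv_0_lt_compat; nra).
    assert (H2 : / (1 + c ^ 2) <= 1)
      by (rewrite <- Rinv_1; apply Rinv_le_contravar; nra).
    rewrite Rabs_pos_eq; nra. }
pose proof (Dirichlet_regularized A T) as HD.
assert (HP : Rabs (RInt (fun t => sinc t * exp (- (A * t))) 0 T) <= 1 / A).
{ apply abs_RInt_exp_decay; try lra.
  - intros y; apply continuous_sinc_exp.
  - intros t _; rewrite Rabs_mult, (Rabs_pos_eq (exp _)) by (left; apply exp_pos).
    apply Rmult_le_compat_r; [left; apply exp_pos|apply sinc_bound]. }
assert (HQ : Rabs (RInt (fun x => exp (- (T * x)) * (cos T + x * sin T)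
                                  / (1 + x ^ 2)) 0 A) <= 2 / T).
{ apply abs_RInt_exp_decay; try lra.
  - intros x; apply (ex_derive_continuous (fun x => exp (- (T * x))
       * (cos T + x * sin T) / (1 + x ^ 2))); auto_derive; nra.
  - intros x Hx; unfold Rdiv; rewrite Rmult_assoc, Rabs_mult, Rmult_comm.
    rewrite (Rabs_pos_eq (exp _)) by (left; apply exp_pos).
    apply Rmult_le_compat_r; [left; apply exp_pos|].
    apply Rabs_le; pose proof (SIN_bound T); pose proof (COS_bound T).
    assert (Hp : 0 < 1 + x ^ 2) by nra.
    assert (- x <= x * sin T <= x) by (split; nra).
    assert (1 + x <= 2 * (1 + x ^ 2)) by nra.
    split; [apply Rle_div_r|apply Rle_div_l]; lra. }
assert (HAe : / A + 1 / A = e) by (unfold A; field; lra).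
set (P := RInt _ 0 T) in *; set (Q := RInt _ 0 A) in *.
apply Rabs_le_between in Ha, HP, HQ.
apply Rabs_le; lra.
Qed.

(** * A vanishing integral: Si(t) cos(2 t)/t *)

(** Si(a t) cos(2 t) / t, with its limit a at t = 0. The scaling a interpolates between
    the zero function and the integrand of K. *)
Definition cos2_Si (a t : R) : R := dslope (fun s => Si (a * s)) a t * cos (2 * t).

Lemma continuous_cos2 t : continuous (fun t => cos (2 * t)) t.
Proof. apply (ex_derive_continuous (fun t => cos (2 * t))); auto_derive; easy. Qed.

Lemma is_derive_Si_scal a t : is_derive (fun s => Si (a * s)) t (a * sinc (a * t)).
Proof.
apply (is_derive_comp Si (fun s => a * s)); [apply is_derive_Si|].
auto_derive; [easy|ring].
Qed.

Lemma sinc_0 : sinc 0 = 1.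
Proof. apply dslope_0. Qed.

Lemma continuous_cos2_Si a t : continuous (cos2_Si a) t.
Proof.
apply (continuous_mult (dslope (fun s => Si (a * s)) a)); [|apply continuous_cos2].
apply continuous_dslope.
- now rewrite Rmult_0_r, Si_0.
- pose proof (is_derive_Si_scal a 0) as Hd.
  now rewrite Rmult_0_r, sinc_0, Rmult_1_r in Hd.
- intros y; apply (ex_derive_continuous (fun s => Si (a * s))).
  eexists; apply is_derive_Si_scal.
Qed.

Lemma is_derive_cos2_Si a t :
  is_derive (fun b => cos2_Si b t) a (sinc (a * t) * cos (2 * t)).
Proof.
unfold cos2_Si; destruct (Req_dec_T t 0) as [->|Ht].
- apply is_derive_ext with (fun b => b * cos (2 * 0)).
  + intros b; now rewrite dslope_0.
  + rewrite !Rmult_0_r, sinc_0; auto_derive; [easy|ring].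
- apply is_derive_ext with (fun b => Si (b * t) / t * cos (2 * t)).
  + intros b; now rewrite dslope_neq0.
  + auto_derive.
    * eexists; apply is_derive_Si.
    * change (fun x => Si x) with Si.
      rewrite (is_derive_unique _ _ _ (is_derive_Si (a * t))).
      field; easy.
Qed.

Lemma is_derive_RInt_cos2_Si T a :
  is_derive (fun b => RInt (cos2_Si b) 0 T) a
    (RInt (fun t => sinc (a * t) * cos (2 * t)) 0 T).
Proof.
apply (is_derive_RInt_param_cont cos2_Si (fun a t => sinc (a * t) * cos (2 * t))).
- intros u t; apply is_derive_cos2_Si.
- intros u t; apply continuity_2d_pt_mult.
  + apply (continuity_1d_2d_pt_comp sinc (fun u t => u * t)).
    * apply continuity_pt_filterlim, continuous_sinc.
    * apply continuity_2d_pt_mult;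
        [apply continuity_2d_pt_id1|apply continuity_2d_pt_id2].
  + apply (continuity_1d_2d_pt_comp (fun t => cos (2 * t)) (fun u t => t)).
    * apply continuity_pt_filterlim, continuous_cos2.
    * apply continuity_2d_pt_id2.
- intros u t; apply continuous_cos2_Si.
Qed.

Lemma continuous_sinc_cos2 a t :
  continuous (fun t => sinc (a * t) * cos (2 * t)) t.
Proof.
apply (continuous_mult (fun t => sinc (a * t))); [|apply continuous_cos2].
apply (continuous_comp (fun t => a * t) sinc); [|apply continuous_sinc].
apply (ex_derive_continuous (fun t => a * t)); auto_derive; easy.
Qed.

(** Linearize 2 sin(a t) cos(2 t) = sin((2 + a) t) - sin((2 - a) t). *)
Lemma RInt_sinc_cos2 a T : a <> 0 ->
  RInt (fun t => sinc (a * t) * cos (2 * t)) 0 T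
  = (Si ((2 + a) * T) - Si ((2 - a) * T)) / (2 * a).
Proof.
intros Ha.
replace ((Si ((2 + a) * T) - Si ((2 - a) * T)) / (2 * a)) with
  (minus ((Si ((2 + a) * T) - Si ((2 - a) * T)) / (2 * a))
         ((Si ((2 + a) * 0) - Si ((2 - a) * 0)) / (2 * a))).
2:{ rewrite !Rmult_0_r, Si_0; unfold minus, plus, opp; simpl; field; easy. }
apply is_RInt_unique, (is_RInt_derive (V := R_CompleteNormedModule)
  (fun t => (Si ((2 + a) * t) - Si ((2 - a) * t)) / (2 * a))).
2: intros t _; apply continuous_sinc_cos2.
intros t _; auto_derive.
- repeat split; eexists; apply is_derive_Si.
- change (fun x => Si x) with Si.
  rewrite !(is_derive_unique _ _ _ (is_derive_Si _)).
  destruct (Req_dec_T t 0) as [->|Ht].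
  + rewrite !Rmult_0_r, sinc_0, cos_0; field; easy.
  + apply Rmult_eq_reg_l with (2 * a * t); [|apply Rmult_integral_contrapositive; lra].
    transitivity ((2 + a) * t * sinc ((2 + a) * t) - (2 - a) * t * sinc ((2 - a) * t)).
    { field; easy. }
    transitivity (2 * (a * t * sinc (a * t)) * cos (2 * t)); [|ring].
    rewrite !sinc_mult, Rmult_plus_distr_r, Rmult_minus_distr_r, sin_plus, sin_minus.
    ring.
Qed.

Lemma Si_lip x y M : 0 < M -> M <= x -> M <= y ->
  Rabs (Si y - Si x) <= Rabs (y - x) / M.
Proof.
intros HM Hx Hy.
destruct (MVT_gen Si x y sinc) as (c & Hc & ->).
- intros t _; apply is_derive_Si.
- intros t _; apply continuity_pt_filterlim, continuous_Si.
- assert (HMc : M <= c) by (pose proof (Rmin_glb x y M Hx Hy); lra).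
  rewrite Rabs_mult, Rmult_comm; apply Rmult_le_compat_l; [apply Rabs_pos|].
  apply Rmult_le_reg_l with M; [easy|]; rewrite Rinv_r by lra.
  apply Rle_trans with (Rabs (c * sinc c)).
  + rewrite Rabs_mult, (Rabs_pos_eq c) by lra.
    apply Rmult_le_compat_r; [apply Rabs_pos|easy].
  + rewrite sinc_mult; apply Rabs_le, SIN_bound.
Qed.

(** Stays bounded as a -> 0: the two arguments of Si in [RInt_sinc_cos2] are 2 a T
    apart and Si is (1/T)-Lipschitz beyond T. *)
Lemma RInt_sinc_cos2_bound a T : 0 < T -> 0 <= a <= 1 ->
  Rabs (RInt (fun t => sinc (a * t) * cos (2 * t)) 0 T) <= 1.
Proof.
intros HT Ha; destruct (Req_dec_T a 0) as [->|Ha0].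
- rewrite (RInt_ext _ (fun t => cos (2 * t))).
  2:{ intros t _; rewrite Rmult_0_l, sinc_0; apply Rmult_1_l. }
  rewrite (is_RInt_unique _ 0 T (minus (sin (2 * T) / 2) (sin (2 * 0) / 2))).
  + rewrite Rmult_0_r, sin_0; unfold minus, plus, opp; simpl.
    apply Rabs_le; pose proof (SIN_bound (2 * T)); lra.
  + apply (is_RInt_derive (V := R_CompleteNormedModule) (fun t => sin (2 * t) / 2)).
    * intros t _; auto_derive; [easy|field].
    * intros t _; apply continuous_cos2.
- rewrite RInt_sinc_cos2 by easy.
  unfold Rdiv; rewrite Rabs_mult, (Rabs_pos_eq (/ _))
    by (left; apply Rinv_0_lt_compat; lra).
  apply Rle_div_l; [lra|].
  eapply Rle_trans; [apply (Si_lip _ _ T); nra|].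
  rewrite Rabs_pos_eq by nra; right; field; lra.
Qed.

(** Decays as T -> +oo at fixed a: both values of Si in [RInt_sinc_cos2] are within
    2/T of PI/2. *)
Lemma RInt_sinc_cos2_decay a T : 0 < T -> 0 < a <= 1 ->
  Rabs (RInt (fun t => sinc (a * t) * cos (2 * t)) 0 T) <= 2 / (a * T).
Proof.
intros HT Ha; rewrite RInt_sinc_cos2 by lra.
assert (H : forall b, 1 <= b -> Rabs (Si (b * T) - PI / 2) <= 2 / T).
{ intros b Hb; eapply Rle_trans; [apply Si_asymptotic; nra|].
  apply Rmult_le_compat_l; [lra|]; apply Rinv_le_contravar; nra. }
pose proof (H (2 + a) ltac:(lra)) as H1; pose proof (H (2 - a) ltac:(lra)) as H2.
apply Rabs_le_between in H1, H2.
unfold Rdiv at 1; rewrite Rabs_mult, (Rabs_pos_eq (/ _))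
  by (left; apply Rinv_0_lt_compat; lra).
apply Rle_div_l; [lra|].
replace (2 / (a * T) * (2 * a)) with (2 / T + 2 / T) by (field; lra).
apply Rabs_le; lra.
Qed.

(** The mean value theorem in the parameter a, on [0, d] with the bound that is uniform
    in a and on [d, 1] with the one that decays in T. *)
Lemma RInt_cos2_Si_bound T d : 0 < T -> 0 < d <= 1 ->
  Rabs (RInt (cos2_Si 1) 0 T) <= d + 2 / (d * T).
Proof.
intros HT Hd.
set (H := fun b => RInt (cos2_Si b) 0 T).
set (H' := fun a => RInt (fun t => sinc (a * t) * cos (2 * t)) 0 T).
assert (HH : forall x y, exists c, Rmin x y <= c <= Rmax x y
                                   /\ H y - H x = H' c * (y - x)).
{ intros x y; apply (MVT_gen H x y H').
  - intros a _; apply is_derive_RInt_cos2_Si.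
  - intros a _; apply continuity_pt_filterlim, (ex_derive_continuous H).
    eexists; apply is_derive_RInt_cos2_Si. }
assert (H0 : H 0 = 0).
{ unfold H; rewrite (RInt_ext _ (fun _ => 0)).
  - rewrite RInt_const; apply (scal_zero_r (V := R_ModuleSpace)).
  - intros t _; unfold cos2_Si, dslope; rewrite Rmult_0_l, Si_0.
    destruct (Req_dec_T t 0); unfold Rdiv; simpl; ring. }
change (Rabs (H 1) <= d + 2 / (d * T)).
destruct (HH 0 d) as (c1 & Hc1 & E1); destruct (HH d 1) as (c2 & Hc2 & E2).
rewrite Rmin_left, Rmax_right in Hc1, Hc2 by lra.
replace (H 1) with (H' c1 * (d - 0) + H' c2 * (1 - d)) by lra.
eapply Rle_trans; [apply Rabs_triang|]; apply Rplus_le_compat;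
  rewrite Rabs_mult, (Rabs_pos_eq (_ - _)) by lra.
- rewrite Rminus_0_r; rewrite <- (Rmult_1_l d) at 2.
  apply Rmult_le_compat_r; [lra|]; apply RInt_sinc_cos2_bound; lra.
- apply Rle_trans with (2 / (c2 * T) * 1).
  + apply Rmult_le_compat; try apply Rabs_pos; try lra.
    apply RInt_sinc_cos2_decay; lra.
  + rewrite Rmult_1_r; apply Rmult_le_compat_l; [lra|].
    apply Rinv_le_contravar; nra.
Qed.

Lemma is_lim_RInt_cos2_Si : is_lim (RInt (cos2_Si 1) 0) p_infty 0.
Proof.
apply is_lim_spec; intros eps; destruct eps as [e He]; simpl.
(* For T > 4 / (d e), each of the terms d and 2 / (d T) is at most e / 2. *)
set (d := Rmin 1 (e / 2)).
assert (Hd : 0 < d) by (apply Rmin_glb_lt; lra).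
assert (Hd1 : d <= 1) by apply Rmin_l.
assert (Hd2 : d <= e / 2) by apply Rmin_r.
assert (Hp : 0 < 4 / (d * e)) by (apply Rdiv_lt_0_compat; nra).
exists (4 / (d * e)); intros T HT; rewrite Rminus_0_r.
eapply Rle_lt_trans; [apply (RInt_cos2_Si_bound T d); lra|].
apply Rlt_div_l in HT; [|nra].
assert (2 / (d * T) < e / 2) by (apply Rlt_div_l; nra).
lra.
Qed.

(** * The antiderivative and its limits *)

(** The derivative is taken on (0, +oo) because the boundary terms of the integrations by
    parts, quotients by powers of t, are differentiated there; continuity takes care of
    the endpoint 0, by the mean value theorem for the difference of both sides. *)
Lemma RInt_open_derive (F g : R -> R) T : 0 < T ->
  (forall t, continuous g t) -> (forall t, continuous F t) ->
  (forall t, 0 < t -> is_derive F t (g t)) ->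
  RInt g 0 T = F T - F 0.
Proof.
intros HT Hg HF HD.
destruct (MVT_gen (fun t => RInt g 0 t - F t) 0 T (fun _ => 0)) as (c & _ & Hc).
- rewrite Rmin_left, Rmax_right by lra; intros t Ht.
  apply (eq_ind (minus (g t) (g t)) (is_derive _ t)); [|apply Rplus_opp_r].
  apply (is_derive_minus (V := R_NormedModule));
    [now apply is_derive_RInt_cont|now apply HD].
- intros t _; apply continuity_pt_filterlim.
  apply (continuous_minus (V := R_NormedModule)); [|apply HF].
  apply (ex_derive_continuous (RInt g 0)); eexists; now apply is_derive_RInt_cont.
- rewrite (RInt_point (V := R_CompleteNormedModule)) in Hc.
  change zero with 0 in Hc; simpl in Hc; lra.
Qed.

(** The outcome of the integrations by parts, as a polynomial in s = Si(t)/t,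
    q = sin(t)/t, c = cos t, K, S = Si(t), S3 = Si(3 t) and u = sin t. The parts
    L, J and E are the antiderivatives of sin t sin(2 t)/t^2, Si(t) sin(2 t)/t^2 and
    (sin t/t)^3; the inner parenthesis after 3/2 is that of Si(t)^2 sin t/t^3. *)
Definition Si3_primitive_poly (s q c K S S3 u : R) : R :=
  let L := - 2 * q * u * c - S / 2 + 3 / 2 * S3 in
  let J := - 2 * s * u * c + L + 2 * K in
  let E := - q ^ 2 * u / 2 + 3 / 4 * L in
  - S * s ^ 2 / 2
  + 3 / 2 * (- s ^ 2 * u / 2
             + 1 / 2 * (- S * q ^ 2 - s * S * c - S ^ 3 / 3 + E + 2 * J)).

Definition Si_slope : R -> R := dslope Si 1.

Definition Si3_primitive (t : R) : R :=
  Si3_primitive_poly (Si_slope t) (sinc t) (cos t) (RInt (cos2_Si 1) 0 t)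
    (Si t) (Si (3 * t)) (sin t).

Lemma continuous_Si_slope t : continuous Si_slope t.
Proof.
apply continuous_dslope.
- apply Si_0.
- rewrite <- sinc_0; apply is_derive_Si.
- apply continuous_Si.
Qed.

Lemma continuous_Si3_primitive t : continuous Si3_primitive t.
Proof.
assert (HK : continuous (RInt (cos2_Si 1) 0) t).
{ apply (ex_derive_continuous (RInt (cos2_Si 1) 0)); eexists.
  apply is_derive_RInt_cont, continuous_cos2_Si. }
pose proof (continuous_Si (3 * t)) as H3.
pose proof (continuous_Si_slope t) as Hs; pose proof (continuous_sinc t) as Hq.
pose proof (continuous_Si t) as HS.
apply continuity_pt_filterlim in HK, H3, Hs, Hq, HS.
apply continuity_pt_filterlim.
unfold Si3_primitive, Si3_primitive_poly; simpl; reg; assumption.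
Qed.

Lemma is_derive_Si3_primitive t : 0 < t -> is_derive Si3_primitive t (Si_slope t ^ 3).
Proof.
intros Ht.
pose proof (is_derive_RInt_cont (cos2_Si 1) t (continuous_cos2_Si 1)) as HK.
unfold cos2_Si at 2 in HK; rewrite dslope_neq0, Rmult_1_l in HK by lra.
revert HK; unfold Si3_primitive; generalize (RInt (cos2_Si 1) 0); intros K HK.
apply is_derive_ext_loc with (fun t => Si3_primitive_poly (Si t / t) (sin t / t) (cos t) (K t)
  (Si t) (Si (3 * t)) (sin t)).
{ apply filter_imp with (2 := locally_neq0 t ltac:(lra)); intros y Hy.
  unfold Si_slope, sinc; now rewrite !dslope_neq0. }
unfold Si_slope; rewrite dslope_neq0 by lra.
assert (H1 := is_derive_Si t); assert (H3 := is_derive_Si (3 * t)).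
unfold sinc in H1, H3; rewrite dslope_neq0 in H1, H3 by lra.
revert HK H1 H3; generalize Si; intros S HK H1 H3.
unfold Si3_primitive_poly; auto_derive.
- repeat split; try lra; eexists; eassumption.
- change (fun x => S x) with S; change (fun x => K x) with K.
  rewrite (is_derive_unique _ _ _ HK), (is_derive_unique _ _ _ H1),
    (is_derive_unique _ _ _ H3).
  replace (3 * t) with (2 * t + t) by ring.
  rewrite sin_plus, sin_2a, cos_2a.
  assert (Hcs : sin t * sin t = 1 - cos t * cos t)
    by (pose proof (sin2_cos2 t) as E; unfold Rsqr in E; lra).
  generalize (S t); intros s; revert Hcs; generalize (sin t) (cos t).
  intros u c Huc.
  (* All powers of 1/t below the third cancel, up to a multiple of u (u^2 + c^2 - 1). *)
  field_simplify_eq; [|lra].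
  replace (u ^ 3) with (u * (u * u)) by ring; rewrite Huc; ring.
Qed.

Lemma is_lim_mult_fin f g (a b : R) :
  is_lim f p_infty a -> is_lim g p_infty b ->
  is_lim (fun t => f t * g t) p_infty (a * b).
Proof. intros Hf Hg; now apply (is_lim_mult f g p_infty a b). Qed.

Lemma is_lim_mult_bounded f g (M : R) :
  is_lim f p_infty 0 -> (forall t, Rabs (g t) <= M) ->
  is_lim (fun t => f t * g t) p_infty 0.
Proof.
intros Hf Hg.
assert (H0 : is_lim (fun t => Rabs (f t) * M) p_infty 0).
{ rewrite <- (Rmult_0_l M), <- Rabs_R0.
  apply (is_lim_mult_fin (fun t => Rabs (f t)) (fun _ => M)).
  - apply (is_lim_Rabs f p_infty 0 Hf).
  - apply is_lim_const. }
apply is_lim_le_le_loc with (fun t => - (Rabs (f t) * M)) (fun t => Rabs (f t) * M).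
- exists 0; intros t _; apply Rabs_le_between; rewrite Rabs_mult.
  apply Rmult_le_compat_l; [apply Rabs_pos|apply Hg].
- rewrite <- Ropp_0; apply (is_lim_opp _ p_infty 0 H0).
- exact H0.
Qed.

Lemma is_lim_Si : is_lim Si p_infty (PI / 2).
Proof.
apply is_lim_spec; intros [e He]; simpl.
assert (0 < 2 / e) by (apply Rdiv_lt_0_compat; lra).
exists (2 / e); intros T HT; assert (0 < T) by lra.
eapply Rle_lt_trans; [apply Si_asymptotic; lra|].
apply Rlt_div_l in HT; [|lra]; apply Rlt_div_l; lra.
Qed.

Lemma is_lim_Rinv_infty : is_lim Rinv p_infty 0.
Proof. apply (is_lim_inv (fun t => t) p_infty p_infty); [apply is_lim_id|easy]. Qed.

Lemma is_lim_sinc : is_lim sinc p_infty 0.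
Proof.
apply is_lim_ext_loc with (fun t => / t * sin t).
- exists 0; intros t Ht; unfold sinc; rewrite dslope_neq0 by lra.
  apply Rmult_comm.
- apply (is_lim_mult_bounded Rinv sin 1 is_lim_Rinv_infty).
  intros t; apply Rabs_le, SIN_bound.
Qed.

Lemma is_lim_Si_slope : is_lim Si_slope p_infty 0.
Proof.
apply is_lim_ext_loc with (fun t => / t * Si t).
- exists 0; intros t Ht; unfold Si_slope; rewrite dslope_neq0 by lra.
  apply Rmult_comm.
- rewrite <- (Rmult_0_l (PI / 2)).
  apply is_lim_mult_fin; [apply is_lim_Rinv_infty|apply is_lim_Si].
Qed.

(** Every monomial of the antiderivative other than Si^3, Si and Si(3 t) contains K or
    one of the factors Si(t)/t and sin(t)/t, and tends to 0. Since sin and cos have no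
    limit, they are first grouped with such a factor. *)
Lemma is_lim_Si3_primitive : is_lim Si3_primitive p_infty (33 / 32 * PI - 1 / 32 * PI ^ 3).
Proof.
assert (HS := is_lim_Si); assert (Hs := is_lim_Si_slope); assert (Hq := is_lim_sinc).
assert (HK := is_lim_RInt_cos2_Si).
assert (H3 : is_lim (fun t => Si (3 * t)) p_infty (PI / 2)).
{ intros P HP; destruct (HS P HP) as [M HM]; exists (M / 3).
  intros t Ht; apply HM; lra. }
assert (HsB : forall f g, (forall t, Rabs (f t) <= 1) -> is_lim g p_infty 0 ->
   is_lim (fun t => g t * f t) p_infty 0).
{ intros f g Hf Hg; now apply (is_lim_mult_bounded g f 1). }
assert (Hsin : forall t, Rabs (sin t) <= 1) by (intros; apply Rabs_le, SIN_bound).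
assert (Hcos : forall t, Rabs (cos t) <= 1) by (intros; apply Rabs_le, COS_bound).
assert (Hsu := HsB _ _ Hsin Hs); assert (Hsc := HsB _ _ Hcos Hs).
assert (Hqu := HsB _ _ Hsin Hq); assert (Hquc := HsB _ _ Hcos Hqu).
assert (Hsuc := HsB _ _ Hcos Hsu).
eassert (HF : is_lim (fun t =>
  - / 2 * (Si t * (Si_slope t * Si_slope t))
  + 3 / 2 * (- / 2 * (Si_slope t * sin t * Si_slope t)
    + / 2 * (- (1) * (Si t * (sinc t * sinc t))
             + - (1) * (Si_slope t * cos t * Si t)
             + - / 3 * (Si t * (Si t * Si t))
             + (- / 2 * (sinc t * (sinc t * sin t))
             + 3 / 4 * (- 2 * (sinc t * sin t * cos t) + - / 2 * Si t
                               + 3 / 2 * Si (3 * t)))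
             + 2 * (- 2 * (Si_slope t * sin t * cos t) +
                    (- 2 * (sinc t * sin t * cos t) + - / 2 * Si t
                               + 3 / 2 * Si (3 * t))
                    + 2 * RInt (cos2_Si 1) 0 t)))) p_infty (Finite _)).
{ repeat first [eassumption | apply is_lim_const
               | eapply is_lim_plus' | eapply is_lim_mult_fin]. }
match type of HF with is_lim _ _ (Finite ?l) =>
  replace (33 / 32 * PI - 1 / 32 * PI ^ 3) with l by (field) end.
eapply is_lim_ext; [|exact HF].
intros t; unfold Si3_primitive, Si3_primitive_poly; simpl; field.
Qed.

Theorem theorem3 :
  is_RInt_gen (fun t : R => (Si t) ^ 3 / t ^ 3)
    (at_point 0) (Rbar_locally p_infty)
    (33 / 32 * PI - 1 / 32 * PI ^ 3).
Proof.
assert (Hc : forall t, continuous (fun t => Si_slope t ^ 3) t).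
{ intros t; apply continuity_pt_filterlim.
  pose proof (continuous_Si_slope t) as Hs; apply continuity_pt_filterlim in Hs.
  reg; assumption. }
apply (filterlimi_lim_ext_loc (fun ab => Si3_primitive (snd ab))).
- exists (fun a => a = 0) (fun b => 0 < b); [easy|now exists 0|].
  intros a b -> Hb; simpl.
  apply is_RInt_ext with (fun t => Si_slope t ^ 3).
  + intros t; rewrite Rmin_left, Rmax_right by lra; intros Ht.
    unfold Si_slope; rewrite dslope_neq0 by lra.
    match goal with |- ?a = ?b => change (@eq R a b) end; field; lra.
  + assert (HF0 : Si3_primitive 0 = 0).
    { unfold Si3_primitive, Si3_primitive_poly; rewrite Rmult_0_r, Si_0, sin_0.
      rewrite (RInt_point (V := R_CompleteNormedModule)); change zero with 0.
      match goal with |- ?a = ?b => change (@eq R a b) end; simpl; field. }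
    replace (Si3_primitive b) with (RInt (fun t => Si_slope t ^ 3) 0 b).
    * apply (RInt_correct (V := R_CompleteNormedModule)), ex_RInt_cont, Hc.
    * rewrite (RInt_open_derive Si3_primitive); [rewrite HF0; apply Rminus_0_r|easy|exact Hc| |].
      -- apply continuous_Si3_primitive.
      -- apply is_derive_Si3_primitive.
- apply (filterlim_comp _ _ _ snd Si3_primitive _ (Rbar_locally p_infty)).
  + apply filterlim_snd.
  + apply is_lim_Si3_primitive.
Qed.
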